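(* Let $G$ be a VPT graph and let $h\geq 3$ be an integer. Then $G\in[h,2,1]$ if and only if the branch graph $B(G/C)$ is $h$-colorable for every clique $C$ of $G$. Moreover, the implication ''$G\in[h,2,1]\Rightarrow B(G/C)$ is $h$-colorable for every clique $C$ of $G$'' also holds for $h=2$.
   Context: All graphs are finite, simple and connected. A clique is a maximal complete set of vertices. An $(h,s,t)$-representation of a graph $G$ is a collection of subtrees $(T_v)_{v\in V(G)}$ of a tree $T$ such that (i) $T$ has maximum degree at most $h$, (ii) every subtree $T_v$ has maximum degree at most $s$, and (iii) two distinct vertices $v,w$ are adjacent in $G$ iff $T_v$ and $T_w$ have at least $t$ vertices in common. $[h,s,t]$ denotes the class of graphs having an $(h,s,t)$-representation; $h=\infty$ or $s=\infty$ means no degree restriction. Thus $[h,2,1]$ is the class of graphs that are vertex-intersection graphs of paths in a tree of maximum degree at most $h$, and VPT $=[\infty,2,1]$. For a clique $C$ of $G$, the branch graph $B(G/C)$ has vertex set the vertices of $V(G)\setminus C$ adjacent to some vertex of $C$, and two such vertices $v,w$ are adjacent in $B(G/C)$ iff (1) $vw\notin E(G)$; (2) some vertex of $C$ is adjacent to both $v$ and $w$; and (3) there exist $v',w'\in C$ with $v'$ adjacent to $v$ but not to $w$, and $w'$ adjacent to $w$ but not to $v$. *)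

(* Defs.v *)
From mathcomp Require Import all_boot.
Set Implicit Arguments. Unset Strict Implicit. Unset Printing Implicit Defensive.

Definition simple_graph (T : finType) (e : rel T) : Prop :=
  symmetric e /\ irreflexive e.

Definition connected_graph (T : finType) (e : rel T) : Prop :=
  (0 < #|T|) /\ (forall x y : T, connect e x y).

Definition acyclic (U : finType) (f : rel U) : Prop :=
  forall (x0 : U) (p : seq U),
    2 <= size p -> uniq (x0 :: p) -> path f x0 p -> ~~ f (last x0 p) x0.

Definition is_tree (U : finType) (f : rel U) : Prop :=
  simple_graph f /\ connected_graph f /\ acyclic f.

Definition restr (U : finType) (f : rel U) (S : {set U}) : rel U :=
  [rel x y | [&& f x y, x \in S & y \in S]].

Definition subtree (U : finType) (f : rel U) (S : {set U}) : Prop :=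
  S != set0 /\ (forall x y, x \in S -> y \in S -> connect (restr f S) x y).

(* Degree bound; None stands for infinity (no restriction). *)
Definition deg_le (U : finType) (f : rel U) (S : {set U}) (b : option nat) : Prop :=
  match b with
  | None => True
  | Some k => forall x, x \in S -> #|[set y in S | f x y]| <= k
  end.

Definition hst_rep (T : finType) (e : rel T) (h s : option nat) (t : nat)
    (U : finType) (f : rel U) (Tv : T -> {set U}) : Prop :=
  [/\ is_tree f,
      deg_le f setT h,
      (forall v, subtree f (Tv v)),
      (forall v, deg_le f (Tv v) s) &
      (forall v w, v != w -> (e v w <-> t <= #|Tv v :&: Tv w|))].

Definition in_hst (T : finType) (e : rel T) (h s : option nat) (t : nat) : Prop :=
  exists (U : finType) (f : rel U) (Tv : T -> {set U}), hst_rep e h s t f Tv.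

Definition VPT (T : finType) (e : rel T) : Prop := in_hst e None (Some 2) 1.

Definition is_clique (T : finType) (e : rel T) (C : {set T}) : Prop :=
  (forall x y, x \in C -> y \in C -> x != y -> e x y) /\
  (forall z, z \notin C -> exists2 x, x \in C & ~~ e z x).

Definition branch_vertices (T : finType) (e : rel T) (C : {set T}) : {set T} :=
  [set v | (v \notin C) && [exists c in C, e v c]].

Definition branch_edge (T : finType) (e : rel T) (C : {set T}) (v w : T) : Prop :=
  [/\ v \in branch_vertices e C, w \in branch_vertices e C,
      ~~ e v w,
      (exists2 c, c \in C & e c v && e c w) &
      ((exists2 v', v' \in C & e v' v && ~~ e v' w) /\
       (exists2 w', w' \in C & e w' w && ~~ e w' v))].

Definition branch_colorable (T : finType) (e : rel T) (C : {set T}) (h : nat) : Prop :=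
  exists col : T -> 'I_h,
    forall v w, branch_edge e C v w -> col v != col w.

(* Main.v *)
(** Root the host tree at a vertex q lying on all paths of a clique C (Helly).
    A path that avoids q lives in a single branch at q, and two such paths in the
    same branch are never adjacent in B(G/C), so the neighbours of q colour B(G/C).

    Conversely, contract host edges qq' for which every path through q passes
    through q'; then the paths through each q form a clique C_q.  Join two
    neighbours of q when some path runs through both.  This graph is h-colourable:
    neighbours y whose set of paths A_y is not contained in another A_z are coloured
    through B(G/C_q), using a path through y that avoids q; any other y is joined
    to a single z.  While q has more than h neighbours, two of them, i and j, share
    a colour, hence no path: detach both from q and hang them from a new
    neighbour of q, of degree 3 <= h.  This lowers the degree of q and keeps the
    local colourings. *)
Require Import Defs.
From mathcomp Require Import all_boot.
Set Implicit Arguments. Unset Strict Implicit. Unset Printing Implicit Defensive.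

(** * Rooted trees *)

Definition up_rel (U : finType) (r : U) (par : U -> U) : rel U :=
  fun x y => (x != r) && (par x == y).

(** The depth [d] is any function decreasing along [par], not necessarily the distance to [r]. This
    slack lets contracted and split trees derive their depth from the original one. The value
    [par r] is arbitrary. *)
Definition rooted (U : finType) (f : rel U) (r : U) (par : U -> U)
    (d : U -> nat) : Prop :=
  (forall x y, f x y = up_rel r par x y || up_rel r par y x) /\
  (forall x, x != r -> d (par x) < d x).

Definition anc_rel (U : finType) (r : U) (par : U -> U) : rel U :=
  connect (up_rel r par).

Lemma connect_morph (U V : finType) (e : rel U) (e' : rel V) (g : U -> V) :
  (forall x y, e x y -> connect e' (g x) (g y)) ->
  forall x y, connect e x y -> connect e' (g x) (g y).
Proof.
move=> h x y /connectP [p]; elim: p x => [|z p IH] x /=; first by move=> _ ->.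
by case/andP=> /h xz /IH zy /zy; apply: connect_trans.
Qed.

Lemma connect_closed (U : finType) (e : rel U) (S : {pred U}) :
  (forall x y, e x y -> x \in S -> y \in S) ->
  forall x y, connect e x y -> x \in S -> y \in S.
Proof.
move=> h x y /connectP [p]; elim: p x => [|z p IH] x /=; first by move=> _ ->.
by case/andP=> xz /IH zy /zy {}zy /(h _ _ xz).
Qed.

Lemma restr_sym (U : finType) (f : rel U) (S : {set U}) :
  symmetric f -> symmetric (restr f S).
Proof. by move=> fS x y; rewrite /restr /= fS (andbC (x \in S)). Qed.

Section RootedTree.
Variables (U : finType) (f : rel U) (r : U) (par : U -> U) (d : U -> nat).
Hypothesis rf : rooted f r par d.
Notation anc := (anc_rel r par).
Notation up := (up_rel r par).

Lemma rooted_adj x y : f x y = up x y || up y x.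
Proof. by case: rf. Qed.

Lemma up_depth x y : up x y -> d y < d x.
Proof. by case: rf => _ h /andP [/h lt /eqP <-]. Qed.

Lemma rooted_sym : symmetric f.
Proof. by move=> x y; rewrite !rooted_adj orbC. Qed.

Lemma rooted_irr : irreflexive f.
Proof.
by move=> x; rewrite rooted_adj orbb; apply/negP=> /up_depth; rewrite ltnn.
Qed.

Lemma up_par x : x != r -> up x (par x).
Proof. by move=> xr; rewrite /up_rel xr eqxx. Qed.

Lemma par_adj x : x != r -> f x (par x).
Proof. by move=> xr; rewrite rooted_adj up_par. Qed.

Lemma par_root_adj x : (par x == r) && (x != r) = f x r.
Proof. by rewrite rooted_adj /up_rel eqxx orbF andbC. Qed.

Lemma adj_root_par x : f r x -> par x = r.
Proof. by rewrite rooted_sym -par_root_adj => /andP [/eqP]. Qed.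

Lemma adj_root_neq x : f r x -> x != r.
Proof. by rewrite rooted_sym -par_root_adj => /andP []. Qed.

Lemma anc_refl x : anc x x.
Proof. exact: connect0. Qed.

Lemma anc_root x : anc x r.
Proof.
have [n] := ubnP (d x); elim: n x => // n IH x lt_n.
have [-> | xr] := eqVneq x r; first exact: anc_refl.
have ux := up_par xr.
apply: connect_trans (connect1 ux) (IH _ _).
exact: leq_trans (up_depth ux) lt_n.
Qed.

Lemma anc_trans : transitive anc.
Proof. exact: connect_trans. Qed.

Lemma anc_depth x y : anc x y -> x != y -> d y < d x.
Proof.
case/connectP=> p; elim: p x => [|z p IH] x /=; first by move=> _ ->; rewrite eqxx.
case/andP=> /up_depth xz /IH zy /zy {}zy _; have [<- // | ne] := eqVneq z y.
exact: ltn_trans (zy ne) xz.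
Qed.

Lemma anc_leq x y : anc x y -> d y <= d x.
Proof. by have [-> // | ne] := eqVneq x y => /anc_depth /(_ ne) /ltnW. Qed.

Lemma anc_par x y : anc x y -> x != y -> (x != r) /\ anc (par x) y.
Proof.
case/connectP=> [[|z p]] /=; first by move=> _ ->; rewrite eqxx.
by case/andP=> /andP [xr /eqP ->] pz -> _; split=> //; apply/connectP; exists p.
Qed.

Lemma anc_of_root x : anc r x -> x = r.
Proof.
by move=> rx; apply/eqP/negPn/negP; rewrite eq_sym => /(anc_par rx) []; rewrite eqxx.
Qed.

Lemma anc_child x y : anc x y -> x != y -> exists2 z, anc x z & up z y.
Proof.
case/connectP=> p; case/lastP: p => [|p z] /=; first by move=> _ ->; rewrite eqxx.
rewrite rcons_path last_rcons => /andP [px uz] -> _.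
by exists (last x p) => //; apply/connectP; exists p.
Qed.

Lemma anc_total x y z : anc x y -> anc x z -> anc y z || anc z y.
Proof.
have [n] := ubnP (d x); elim: n x => // n IH x lt_n xy xz.
have [<- | nxy] := eqVneq x y; first by rewrite xz.
have [<- | nxz] := eqVneq x z; first by rewrite xy orbT.
have [xr pxy] := anc_par xy nxy; have [_ pxz] := anc_par xz nxz.
exact: IH (leq_trans (up_depth (up_par xr)) lt_n) pxy pxz.
Qed.

Lemma anc_children_eq x y z : f r y -> f r z -> anc x y -> anc x z -> y = z.
Proof.
wlog yz : y z / anc y z => [h fy fz xy xz|].
  by case/orP: (anc_total xy xz) => h'; [apply: h | apply/esym/h].
move=> fy fz _ _; apply/eqP/negPn/negP=> /(anc_par yz) [_].
by rewrite (adj_root_par fy) => /anc_of_root zr; move: (adj_root_neq fz); rewrite zr eqxx.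
Qed.

(** Contracted and split hosts are recognised as trees through this lemma, so acyclicity is proved
    only once. *)
Lemma rooted_tree : is_tree f.
Proof.
split; [|split]; first by split; [exact: rooted_sym | exact: rooted_irr].
  split; first by apply/card_gt0P; exists r.
  have cr x : connect f x r.
    apply: connect_sub (anc_root x) => a b ab.
    by apply: connect1; rewrite rooted_adj ab.
  move=> x y; apply: connect_trans (cr x) _.
  by rewrite (sym_connect_sym rooted_sym).
move=> x0 p p2 up0 pp; apply/negP=> fl.
(* Both neighbours on the cycle of a deepest vertex would be its parent. *)
have cyc : cycle f (x0 :: p) by rewrite /= rcons_path pp.
have x0in : x0 \in x0 :: p by rewrite mem_head.
case: (arg_maxnP d x0in) => m mp mmax.
have [i s E] := rot_to mp.
have : cycle f (m :: s) by rewrite -E rot_cycle.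
have : uniq (m :: s) by rewrite -E rot_uniq.
have : 2 <= size s by rewrite -ltnS -[(size s).+1]/(size (m :: s)) -E size_rot.
have smax y : y \in m :: s -> d y <= d m.
  by rewrite -E mem_rot => /mmax.
case: s smax {E} => [|y [|z s]] //= smax _ uq.
rewrite rcons_path => /and4P [fmy fyz pzs flm].
have par_eq w : w \in m :: [:: y, z & s] -> f m w -> par m = w.
  move=> win; rewrite rooted_adj => /orP [/andP [_ /eqP //]|/up_depth].
  by rewrite ltnNge smax.
have := par_eq y; rewrite !inE eqxx orbT => /(_ isT fmy) Ey.
have := par_eq (last z s); rewrite rooted_sym inE in_cons mem_last !orbT => /(_ isT flm) El.
by case/and3P: uq => _; rewrite -Ey El mem_last.
Qed.

(** [t] is a vertex of [S] of least depth. If another [x] in [S] were the root or had its parent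
    outside [S], the descendants of [x] in [S] would be closed under adjacency in [S], hence contain
    [t], which would then lie deeper than [x]. *)
Lemma subtree_top S : subtree f S ->
  exists t, [/\ t \in S, forall x, x \in S -> anc x t &
                forall x, x \in S -> x != t -> (x != r) && (par x \in S)].
Proof.
case=> /set0Pn [s sS] cS; case: (arg_minnP d sS) => t tS tmin.
have top x : x \in S -> x != t -> (x != r) && (par x \in S).
  move=> xS xt; apply/negPn/negP=> npar.
  have : t \in [pred y | (y \in S) && anc y x].
    apply: (connect_closed _ (cS _ _ xS tS)); last by rewrite inE xS anc_refl.
    move=> a b /and3P [fab _ bS]; rewrite !inE bS => /andP [_ ax] /=.
    move: fab; rewrite rooted_adj => /orP [ab|/connect1 ba]; last exact: anc_trans ba ax.
    have [ax'|nax] := eqVneq a x.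
      by move: npar; case/andP: ab; rewrite -ax' => -> /eqP ->; rewrite bS.
    by have [_] := anc_par ax nax; case/andP: ab => _ /eqP ->.
  case/andP=> _ /anc_depth; rewrite eq_sym => /(_ xt).
  by rewrite ltnNge tmin.
exists t; split=> // x; have [n] := ubnP (d x); elim: n x => // n IH x lt_n xS.
have [-> | xt] := eqVneq x t; first exact: anc_refl.
have /andP [xr pS] := top x xS xt.
have ux := up_par xr.
exact: anc_trans (connect1 ux) (IH _ (leq_trans (up_depth ux) lt_n) pS).
Qed.

(** Closure under parents is asked only strictly below [y], so the climb may end at [y] even where
    [S] does not continue upwards. *)
Lemma anc_in (S : {set U}) x y :
  (forall z, z \in S -> anc z y -> z != y -> z != r -> par z \in S) ->
  anc x y -> x \in S -> y \in S.
Proof.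
move=> pS; have [n] := ubnP (d x); elim: n x => // n IH x lt_n xy xS.
have [<- // | ne] := eqVneq x y; have [xr pxy] := anc_par xy ne.
exact: IH (leq_trans (up_depth (up_par xr)) lt_n) pxy (pS _ xS xy ne xr).
Qed.

Lemma subtree_par S x :
  subtree f S -> r \in S -> x \in S -> x != r -> par x \in S.
Proof.
move=> /subtree_top [t [tS _ tp]] rS xS.
have -> : r = t by apply/eqP/negPn/negP=> /(tp _ rS) /andP [/eqP].
by move=> /(tp _ xS) /andP [_ ->].
Qed.

Lemma subtree_anc S x y :
  subtree f S -> r \in S -> anc x y -> x \in S -> y \in S.
Proof. by move=> sS rS; apply: anc_in => z zS _ _; apply: subtree_par. Qed.

Lemma subtree_branch S y :
  subtree f S -> r \notin S -> f r y -> y \in S -> forall x, x \in S -> anc x y.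
Proof.
move=> /subtree_top [t [tS xt tp]] rS fy yS.
suff -> : y = t by [].
apply/eqP/negPn/negP=> /(tp _ yS) /andP [_].
by rewrite (adj_root_par fy) (negPf rS).
Qed.

Lemma subtree_in_branch S :
  subtree f S -> r \notin S ->
  exists2 y, f r y & forall x, x \in S -> anc x y.
Proof.
move=> /subtree_top [t [tS xt _]] rS.
have tr : t != r by apply: contraNneq rS => <-.
have [y ty uy] := anc_child (anc_root t) tr.
exists y => [|x /xt xy]; first by rewrite rooted_adj uy orbT.
exact: anc_trans xy ty.
Qed.

(* Among the tops of the subtrees, a deepest one lies in all of them. *)
Lemma helly (I : finType) (F : I -> {set U}) (A : {set I}) :
  A != set0 -> (forall i, subtree f (F i)) ->
  (forall i j, i \in A -> j \in A -> F i :&: F j != set0) ->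
  exists q, forall i, i \in A -> q \in F i.
Proof.
move=> /set0Pn [i0 i0A] sF meet.
have [top topP] := fin_all_exists (fun i => subtree_top (sF i)).
case: (arg_maxnP (fun i => d (top i)) i0A) => i iA imax.
exists (top i) => j jA; have /set0Pn [x] := meet i j iA jA.
rewrite inE => /andP [xi xj].
have [_ ai _] := topP i; have [tj aj pj] := topP j.
have [ -> // | ne] := eqVneq (top i) (top j).
(* Both tops lie above the common point [x], hence are comparable; by the choice of [i], the top of
   [j] cannot be the lower one. *)
have ij : anc (top i) (top j).
  case/orP: (anc_total (ai x xi) (aj x xj)) => // ji.
  have := anc_depth ji; rewrite eq_sym => /(_ ne).
  by rewrite ltnNge; have /= -> := imax j jA.
apply: (anc_in _ (ai x xi) xj) => z zj zi nz _.
have [zt|zt] := eqVneq z (top j); last by have /andP [] := pj z zj zt.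
by have := anc_depth zi nz; rewrite zt ltnNge (anc_leq ij).
Qed.

End RootedTree.

Lemma tree_rooted (U : finType) (f : rel U) (r : U) :
  is_tree f -> exists par d, rooted f r par d.
Proof.
move=> [[fS fI] [[_ fC] fA]].
(* [P x n] asserts a walk of length [n] from [x] to [r]. The least such [n] gives [d], and the first
   step of a shortest walk gives [par]. *)
pose P x n := [exists t : n.-tuple U, path f x t && (last x t == r)].
have [x|d dP] := @fin_all_exists U (fun=> nat)
    (fun x n => P x n /\ forall m, P x m -> n <= m).
  have exP : exists n, P x n.
    have /connectP [p px rl] := fC x r.
    by exists (size p); apply/existsP; exists (in_tuple p); rewrite /= px rl eqxx.
  by case: (ex_minnP exP) => n Pn nmin; exists n.
have [x|par parP] := @fin_all_exists U (fun=> U)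
    (fun x y => x != r -> f x y /\ d y < d x).
  have [xr|xr] := eqVneq x r; first by exists x.
  have [/existsP [[[|y p] /= /eqP sp]] + _] := dP x.
    by rewrite (negPf xr).
  case/andP=> /andP [fxy py] ly; exists y => _; split=> //.
  rewrite -sp ltnS; apply: (dP y).2; apply/existsP.
  by exists (in_tuple p); rewrite /= py.
exists par, d; split=> [x y|x /parP [] //].
apply/idP/idP=> [fxy|]; last first.
  by case/orP=> /andP [/parP [h _] /eqP <-]; rewrite // fS.
(* Otherwise climbing to the root from both ends avoids the edge, which would
   then close a cycle. *)
apply/negPn/negP=> /norP [nxy nyx].
pose g := [rel a b | f a b && ~~ [|| (a == x) && (b == y) | (a == y) && (b == x)]].
have gS : symmetric g.
  move=> a b; rewrite /= fS; congr (_ && ~~ _).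
  by rewrite orbC (andbC (a == y)) (andbC (a == x)).
have gr z : connect g z r.
  have [n] := ubnP (d z); elim: n z => // n IH z lt_n.
  have [->|zr] := eqVneq z r; first exact: connect0.
  have [fz dz] := parP z zr.
  apply: connect_trans (IH _ (leq_trans dz lt_n)); apply: connect1.
  rewrite /= fz /=; apply/norP; split; apply/andP=> -[/eqP E1 /eqP E2].
    by case/negP: nxy; rewrite /up_rel -E1 zr E2 eqxx.
  by case/negP: nyx; rewrite /up_rel -E1 zr E2 eqxx.
have : connect g x y by apply: connect_trans (gr x) _; rewrite (sym_connect_sym gS).
case/connectP=> p0 gp0 yl; case: (shortenP gp0) yl => p gp up _ yl.
have fp : path f x p by apply: sub_path gp => a b /andP [].
have := fA x p; rewrite -yl fS fxy => /(_ _ up fp) h.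
suff : 1 < size p by move/h.
case: p gp {up fp h} yl => [|a [|b p]] //= gp yl; last first.
  by move: gp; rewrite -yl !eqxx andbF.
by rewrite yl fI in fxy.
Qed.

(** If [a] and [b] were incomparable, their deepest common ancestor [m] would have three neighbours
    in [S]: one towards [a], one towards [b], and its parent. The parent exists because [m] is at
    least as deep as [y], hence not the root. *)
Lemma subtree_chain (U : finType) (f : rel U) r par d S y a b :
  rooted f r par d -> subtree f S -> deg_le f S (Some 2) -> r \in S ->
  f r y -> a \in S -> b \in S ->
  anc_rel r par a y -> anc_rel r par b y -> anc_rel r par a b || anc_rel r par b a.
Proof.
move=> rf sS dS rS fy aS bS ay by_.
have Py : (anc_rel r par a y) && (anc_rel r par b y) by rewrite ay.
case: (@arg_maxnP _ _ [pred m | anc_rel r par a m && anc_rel r par b m] d Py).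
move=> m /= /andP [am bm] mmax.
have [->|nam] := eqVneq a m; first by rewrite bm orbT.
have [->|nbm] := eqVneq b m; first by rewrite am.
have [a' aa' ua] := anc_child am nam; have [b' bb' ub] := anc_child bm nbm.
have nab : a' != b'.
  apply: contraTneq (up_depth rf ua) => E; rewrite -leqNgt; apply: mmax.
  by rewrite aa' E bb'.
have mS := subtree_anc rf sS rS am aS.
have a'S := subtree_anc rf sS rS aa' aS.
have b'S := subtree_anc rf sS rS bb' bS.
have mr : m != r.
  apply: contraTneq (mmax y Py) => ->; rewrite -ltnNge.
  by apply: (up_depth rf); rewrite /up_rel (adj_root_par rf fy) (adj_root_neq rf fy) eqxx.
have pS := subtree_par rf sS rS mS mr.
have pm := up_depth rf (up_par _ mr).
have := dS m mS; rewrite leqNgt => /negP []; apply: leq_trans (subset_leq_card (_ :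
  [set a'; b'; par m] \subset _)); last first.
  apply/subsetP=> z; rewrite !inE (rooted_adj rf).
  case/orP=> [/orP []|] /eqP ->; rewrite ?a'S ?b'S ?pS ?ua ?ub ?orbT //.
  by rewrite up_par.
rewrite -setUA cardsU1 cards2 !inE negb_or nab.
have pa : a' != par m.
  by apply: contraTneq (ltn_trans pm (up_depth rf ua)) => ->; rewrite ltnn.
have pb : b' != par m.
  by apply: contraTneq (ltn_trans pm (up_depth rf ub)) => ->; rewrite ltnn.
by rewrite pa pb.
Qed.

(** * Colouring branch graphs from a representation *)

Lemma rep_adjP (T : finType) (e : rel T) h s (U : finType) (f : rel U) Tv v w :
  hst_rep e h s 1 f Tv -> v != w ->
  reflect (exists2 x, x \in Tv v & x \in Tv w) (e v w).
Proof.
case=> _ _ _ _ adj /adj vw; apply: (iffP idP) => [/vw /card_gt0P [x]|[x xv xw]].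
  by rewrite inE => /andP [xv xw]; exists x.
by apply/vw/card_gt0P; exists x; rewrite inE xv.
Qed.

Lemma rep_branch_colorable (T : finType) (e : rel T) h (U : finType)
    (f : rel U) Tv C :
  simple_graph e -> hst_rep e (Some h.+1) (Some 2) 1 f Tv -> C != set0 ->
  is_clique e C -> branch_colorable e C h.+1.
Proof.
move=> [eS eI] rep C0 [Cadj Cmax].
have [tf dU sT dT _] := rep.
have [_ [[/card_gt0P [r0 _] _] _]] := tf.
have [p0 [d0 rf0]] := tree_rooted r0 tf.
have [i j iC jC|q qC] := helly rf0 C0 sT (_ : forall i j, _ -> _ -> _).
  have [<-|nij] := eqVneq i j; first by rewrite setIid; case: (sT i).
  have /(rep_adjP rep nij) [x xi xj] := Cadj i j iC jC nij.
  by apply/set0Pn; exists x; rewrite inE xi.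
have {rf0 p0 d0 r0} [par [d rf]] := tree_rooted q tf.
have qnC v : v \notin C -> q \notin Tv v.
  move=> vC; have [c cC /negP nec] := Cmax v vC; apply/negP=> qv; apply: nec.
  have vc : v != c by apply: contraNneq vC => ->.
  by apply/(rep_adjP rep vc); exists q => //; exact: qC.
have [v|br brP] := @fin_all_exists T (fun=> U) (fun v y => q \notin Tv v ->
    f q y /\ forall x, x \in Tv v -> anc_rel q par x y).
  have [qv|qv] := boolP (q \in Tv v); first by exists q.
  by have [y fy yP] := subtree_in_branch rf (sT v) qv; exists y.
pose N := [set y in [set: U] | f q y].
have Nh : #|N| <= h.+1 by apply: (dU q); rewrite inE.
(* The colour is the position of the branch among the neighbours of [q]. For vertices outside [C],
   the only ones compared, this position is below [#|N|], so [inord] does not alter it. *)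
exists (fun v => inord (index (br v) (enum N))).
suff sep v w : v \notin C -> w \notin C -> ~~ e v w ->
    (exists2 c, c \in C & e c v && e c w) ->
    (exists2 v', v' \in C & e v' v && ~~ e v' w) ->
    (exists2 w', w' \in C & e w' w && ~~ e w' v) -> br v != br w.
  move=> v w [+ + evw cvw [v'P w'P]]; rewrite !inE => /andP [vC _] /andP [wC _].
  have NV u : u \notin C -> br u \in enum N.
    by move=> /qnC /brP [fu _]; rewrite mem_enum !inE.
  have lt u : u \notin C -> index (br u) (enum N) < h.+1.
    by move=> /NV; rewrite -index_mem -cardE => h1; apply: leq_trans h1 Nh.
  have := sep v w vC wC evw cvw v'P w'P; apply: contraNneq => /(congr1 val) /=.
  by rewrite !inordK ?lt // => E; apply/eqP; rewrite -(nth_index q (NV v vC)) E nth_index ?NV.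
move=> vC wC evw [c cC /andP [ecv ecw]] v'P w'P; apply/negP=> /eqP Ebr.
have nin u z : u \notin C -> z \in C -> z != u.
  by move=> uC zC; apply: contraNneq uC => <-.
have [fy vy] := brP v (qnC v vC); have [_ wy] := brP w (qnC w wC).
rewrite -Ebr in wy.
have /(rep_adjP rep (nin _ _ vC cC)) [a ac av] := ecv.
have /(rep_adjP rep (nin _ _ wC cC)) [b bc bw] := ecw.
(* [Tv c] passes through [q] and meets both [Tv v] and [Tv w] inside one branch; being a path, it
   descends that branch along a single line. *)
have chain := subtree_chain rf (sT c) (dT c) (qC c cC) fy ac bc (vy a av) (wy b bw).
(* If T_v separates T_w from q on T_c, every T_z through q meeting T_w meets T_v. *)
have key v1 w1 a1 b1 : v1 \notin C -> w1 \notin C -> ~~ e v1 w1 -> v1 != w1 ->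
    a1 \in Tv v1 -> b1 \in Tv w1 -> anc_rel q par b1 a1 ->
    ~ (exists2 w', w' \in C & e w' w1 && ~~ e w' v1).
  move=> v1C w1C ev1w1 nvw a1v b1w b1a1 [z zC /andP [ezw /negP []]].
  apply/(rep_adjP rep (nin _ _ v1C zC)); exists a1 => //.
  have /(rep_adjP rep (nin _ _ w1C zC)) [x xz xw] := ezw.
  have [t [tw at_ tp]] := subtree_top rf (sT w1).
  have tz := subtree_anc rf (sT z) (qC z zC) (at_ x xw) xz.
  have : a1 \in Tv w1 :|: Tv z.
    apply: (anc_in rf _ b1a1); last by rewrite inE b1w.
    move=> y + _ _ yq; rewrite !inE => /orP [yw|yz].
      have [E|ty] := eqVneq y t; last by have /andP [_ ->] := tp y yw ty.
      by rewrite (subtree_par rf (sT z)) ?qC ?orbT // E.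
    by rewrite (subtree_par rf (sT z)) ?qC ?orbT.
  rewrite inE => /orP [a1w|//]; case/negP: ev1w1.
  by apply/(rep_adjP rep nvw); exists a1.
have nvw : v != w.
  by have [z _ /andP [ez nez]] := v'P; apply: contraNneq nez => <-.
case/orP: chain => [ab|ba]; last exact: (key v w a b).
by apply: (key w v b a); rewrite // 1?eS // eq_sym.
Qed.

(** * Contraction *)

(** No edge is left to contract. The premise that some path meets [q] exempts vertices already
    contracted, which stay in the host on no path. *)
Definition reduced (T U : finType) (f : rel U) (Tv : T -> {set U}) : Prop :=
  forall q q', f q q' -> (exists v, q \in Tv v) ->
    exists2 v, q \in Tv v & q' \notin Tv v.

Definition locally_colorable (T U : finType) (f : rel U) (Tv : T -> {set U})
    (h : nat) : Prop :=
  forall q, exists col : U -> 'I_h, forall v y z,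
    q \in Tv v -> y \in Tv v -> z \in Tv v -> f q y -> f q z -> y != z ->
    col y != col z.

Section Contract.
Variables (U : finType) (f : rel U) (q q' : U) (par : U -> U) (d : U -> nat).
Hypotheses (rf : rooted f q' par d) (fq : f q' q).

(* The contracted vertex q is kept as a leaf at q', lying on no path, so that the
   host type does not change. *)
Definition contract_par (x : U) : U := if par x == q then q' else par x.

Definition contract_adj : rel U :=
  fun x y => up_rel q' contract_par x y || up_rel q' contract_par y x.

(** The old depth still works: a child of [q] is merely moved to [q'], which is higher than [q]. *)
Lemma contract_rooted : rooted contract_adj q' contract_par d.
Proof.
split=> // x xq'; rewrite /contract_par.
have := up_depth rf (up_par par xq').
case: eqP => // ->; apply: ltn_trans.
have := up_depth rf (up_par par (adj_root_neq rf fq)).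
by rewrite (adj_root_par rf fq).
Qed.

Lemma contract_up_par x : x != q' -> contract_adj x (contract_par x).
Proof. exact: (par_adj contract_rooted). Qed.

Lemma contract_up x y : x != q -> x != q' -> contract_adj x y ->
  y = contract_par x \/ y != q' /\ par y = x.
Proof.
move=> xq xq' /orP [/andP [_ /eqP ->]|/andP [yq' /eqP]]; first by left.
rewrite /contract_par; case: eqP => [_ E|_ E]; last by right.
by rewrite E eqxx in xq'.
Qed.

Variable S : {set U}.
Hypotheses (sS : subtree f S) (qS : q \in S -> q' \in S).

(** Connectivity is carried over by the map [g] that sends [q] to [q'] and fixes the rest: the edge
    [qq'] collapses and every other edge goes to an edge. *)
Lemma contract_subtree : subtree contract_adj (S :\ q).
Proof.
have nqq' : q' != q by rewrite eq_sym (adj_root_neq rf fq).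
have [S0 cS] := sS; split.
  have /set0Pn [x xS] := S0; apply/set0Pn.
  have [E|xq] := eqVneq x q; last by exists x; rewrite !inE xq.
  by exists q'; rewrite !inE nqq' qS // -E.
pose g x := if x == q then q' else x.
have gS x : x \in S -> g x \in S :\ q.
  rewrite /g; case: eqP => [->|/eqP xq xS]; rewrite !inE ?xq //.
  by rewrite nqq' => /qS.
have rS := restr_sym (S :\ q) (rooted_sym contract_rooted).
have up_g x y : x \in S -> y \in S -> up_rel q' par x y ->
    connect (restr contract_adj (S :\ q)) (g x) (g y).
  move=> xS yS /andP [xq' /eqP Ey].
  have gxS := gS x xS; have gyS := gS y yS.
  have [E|xq] := eqVneq x q.
    rewrite -Ey E (adj_root_par rf fq) /g eqxx (negPf nqq'); exact: connect0.
  have Eg : g y = contract_par (g x) by rewrite /contract_par /g (negPf xq) Ey.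
  have Egx : g x = x by rewrite /g (negPf xq).
  apply: connect1; rewrite /restr /= gxS gyS !andbT Eg.
  by apply: contract_up_par; rewrite Egx.
move=> x y; rewrite !inE => /andP [xq xS] /andP [yq yS].
have := @connect_morph _ _ (restr f S) (restr contract_adj (S :\ q)) g.
move=> /(_ _ x y (cS x y xS yS)); rewrite /g (negPf xq) (negPf yq); apply.
move=> a b /and3P [fab aS bS].
move: fab; rewrite (rooted_adj rf) => /orP [|] /up_g; first exact.
by rewrite (sym_connect_sym rS); apply.
Qed.

(** Two adjacent vertices of a path have at most one further neighbour each, so the merged vertex
    has at most two. A child of [q] exchanges its neighbour [q] for [q']. *)
Lemma contract_deg : deg_le f S (Some 2) -> deg_le contract_adj (S :\ q) (Some 2).
Proof.
have nqq' : q' != q by rewrite eq_sym (adj_root_neq rf fq).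
move=> dS y; rewrite !inE => /andP [yq yS].
have [Ey|yq'] := eqVneq y q'.
  have nbr z : contract_adj q' z -> z != q' /\ (par z = q' \/ par z = q).
    rewrite /contract_adj /up_rel eqxx /= => /andP [zq' /eqP].
    by rewrite /contract_par; case: eqP => ? ?; split=> //; [right | left].
  have rS : q' \in S by rewrite -Ey.
  have cq' := dS q' rS.
  rewrite Ey; have [qiS|qnS] := boolP (q \in S); last first.
    apply: leq_trans cq'; apply: subset_leq_card; apply/subsetP=> z; rewrite !inE.
    case/andP=> /andP [zq zS] /nbr [zq' [E|E]].
      by rewrite zS (rooted_sym rf) -E; apply: (par_adj rf).
    by have := subtree_par rf sS rS zS zq'; rewrite E (negPf qnS).
  have cq := dS q qiS.
  have : [set z in S :\ q | contract_adj q' z] \subset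
    ([set z in S | f q' z] :\ q) :|: ([set z in S | f q z] :\ q').
    apply/subsetP=> z; rewrite !inE => /andP [/andP [zq zS] /nbr [zq' E]].
    rewrite zq zq' zS /= !(rooted_sym rf _ z) /=.
    by case: E => <-; rewrite (par_adj rf zq') ?orbT.
  move/subset_leq_card/leq_trans; apply; apply: leq_trans (leq_card_setU _ _) _.
  move: cq cq'; rewrite (cardsD1 q' [set z in S | f q z]) (cardsD1 q [set z in S | f q' z]).
  rewrite !inE qiS rS fq (rooted_sym rf) fq !add1n !ltnS => c1 c2.
  exact: (leq_add c2 c1).
have nbr z : z \in [set z in S :\ q | contract_adj y z] ->
    z != contract_par y -> z \in [set z in S | f y z].
  rewrite !inE => /andP [/andP [zq zS] /(contract_up yq yq') [->|[zq' E]]].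
    by rewrite eqxx.
  by rewrite zS (rooted_sym rf) -E => _; apply: (par_adj rf).
apply: leq_trans (dS y yS).
have [Epar|npar] := boolP ((par y == q) && (q' \in S)); last first.
  apply: subset_leq_card; apply/subsetP=> z zN.
  have [E|] := eqVneq z (contract_par y); last exact: nbr.
  move: zN; rewrite !inE => /andP [/andP [zq zS] _]; rewrite zS.
  move: E npar; rewrite /contract_par; case: ifP => [_ <-|_ -> _].
    by rewrite zS.
  exact: (par_adj rf).
case/andP: Epar => /eqP Epar rS.
have qiS : q \in S by rewrite -Epar; apply: (subtree_par rf).
have -> : [set z in S | f y z] = q |: ([set z in S | f y z] :\ q).
  by rewrite setD1K // !inE qiS -Epar; apply: (par_adj rf).
rewrite cardsU1 !inE eqxx /= add1n.
have : [set z in S :\ q | contract_adj y z] \subset q' |: ([set z in S | f y z] :\ q).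
  apply/subsetP=> z zN; rewrite inE in_set1; case: eqP => //= /eqP zq'.
  rewrite in_setD1 nbr // ?andbT; first by move: zN; rewrite !inE => /andP [/andP []].
  by rewrite /contract_par Epar eqxx.
move/subset_leq_card/leq_trans; apply.
by rewrite cardsU1 -add1n leq_add2r leq_b1.
Qed.

End Contract.

Lemma reduced_rep (T : finType) (e : rel T) (U : finType) (f : rel U) Tv :
  hst_rep e None (Some 2) 1 f Tv ->
  exists (f' : rel U) Tv', hst_rep e None (Some 2) 1 f' Tv' /\ reduced f' Tv'.
Proof.
(* The measure counts only host vertices lying on some path, since a contraction does not shrink the
   host type. *)
have [n] := ubnP #|[set x | [exists v, x \in Tv v]]|.
elim: n f Tv => // n IH f Tv lt_n rep.
have [/existsP [q /existsP [q' /and3P [fqq' /existsP [u qu] /forallP qq']]]|nred] :=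
  boolP [exists q, exists q', [&& f q q', [exists v, q \in Tv v] &
           [forall v, (q \in Tv v) ==> (q' \in Tv v)]]]; last first.
  exists f, Tv; split=> // q q' fqq' [u qu].
  have : ~~ [forall v, (q \in Tv v) ==> (q' \in Tv v)].
    apply: contra nred => h; apply/existsP; exists q; apply/existsP; exists q'.
    by rewrite fqq' h andbT; apply/existsP; exists u.
  by rewrite negb_forall => /existsP [v]; rewrite negb_imply => /andP []; exists v.
have {}qq' v : q \in Tv v -> q' \in Tv v by have /implyP := qq' v.
have [tf _ sT dT adj] := rep.
have [par [d rf]] := tree_rooted q' tf.
have fq : f q' q by rewrite (rooted_sym rf).
have nqq' : q' != q by rewrite eq_sym (adj_root_neq rf fq).
apply: (IH (contract_adj q q' par) (fun v => Tv v :\ q)).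
  rewrite ltnS in lt_n; apply: leq_trans lt_n; apply: proper_card; apply/properP.
  split; last first.
    exists q; rewrite inE; first by apply/existsP; exists u.
    by apply/existsP=> -[v]; rewrite !inE eqxx.
  by apply/subsetP=> x; rewrite !inE => /existsP [v]; rewrite inE => /andP [_ xv];
     apply/existsP; exists v.
split=> //; first exact: (rooted_tree (contract_rooted rf fq)).
- by move=> v; apply: (contract_subtree rf fq (sT v) (qq' v)).
- by move=> v; apply: (contract_deg rf fq (sT v) (dT v)).
move=> v w /adj adj_vw; apply: (iff_trans adj_vw).
split=> /card_gt0P [x]; rewrite !inE => /andP [xv xw]; apply/card_gt0P; last first.
  by exists x; rewrite inE; case/andP: xv => _ ->; case/andP: xw.
have [E|xq] := eqVneq x q; last by exists x; rewrite !inE xq xv.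
by exists q'; rewrite !inE nqq' !qq' // -E.
Qed.

(** For maximality, suppose [z] avoids [q] but is adjacent to every path through [q]. By Helly all
    these paths and that of [z] share a vertex [r]; then the neighbour of [q] towards [r] lies on
    every path through [q], against [reduced]. *)
Lemma reduced_clique (T : finType) (e : rel T) h s (U : finType) (f : rel U) Tv q :
  simple_graph e -> hst_rep e h s 1 f Tv -> reduced f Tv ->
  (exists v, q \in Tv v) -> is_clique e [set v | q \in Tv v].
Proof.
move=> [eS eI] rep red [u qu]; have [tf _ sT _ _] := rep.
split=> [x y|z]; rewrite !inE => qx.
  by move=> qy xy; apply/(rep_adjP rep xy); exists q.
have [/existsP [x /andP [xC ezx]]|nex] :=
  boolP [exists x, (q \in Tv x) && ~~ e z x]; first by exists x; rewrite ?inE.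
have {nex} ez x : q \in Tv x -> e z x.
  by move=> xq; apply/negPn/negP=> ne; case/existsP: nex; exists x; rewrite xq.
have [p0 [d0 rf0]] := tree_rooted q tf.
have [||r rP] := @helly _ _ _ _ _ rf0 _ Tv (z |: [set v | q \in Tv v]) _ sT.
- by apply/set0Pn; exists z; rewrite setU11.
- have meet i j : i \in z |: [set v | q \in Tv v] -> q \in Tv j -> Tv i :&: Tv j != set0.
    rewrite !inE => /orP [/eqP ->|qi] qj; apply/set0Pn; last first.
      by exists q; rewrite inE qi.
    have zj : z != j by apply: contraNneq qx => ->.
    by have /(rep_adjP rep zj) [x xz xj] := ez j qj; exists x; rewrite inE xz.
  move=> i j iA; rewrite !inE => /orP [/eqP ->|qj]; last exact: meet.
  move: iA; rewrite !inE => /orP [/eqP ->|qi]; first by rewrite setIid; case: (sT z).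
  by rewrite setIC; apply: meet => //; rewrite setU11.
have [par [d rf]] := tree_rooted r tf.
have qr : q != r by apply: contraNneq qx => ->; apply: rP; rewrite setU11.
have [v qv /negP []] := red q (par q) (par_adj rf qr) (ex_intro _ u qu).
by apply: (subtree_par rf (sT v) _ qv qr); apply: rP; rewrite !inE qv orbT.
Qed.

(** * Local colourings from branch graphs *)

Lemma deg2_nbr (U : finType) (f : rel U) S q x y z :
  deg_le f S (Some 2) -> q \in S -> x \in S -> y \in S -> z \in S ->
  f q x -> f q y -> f q z -> x != y -> x != z -> y = z.
Proof.
move=> dS qS xS yS zS fx fy fz xy xz; apply/eqP/negPn/negP=> yz.
have := dS q qS; rewrite leqNgt => /negP []; apply: leq_trans (subset_leq_card (_ :
  [set x; y; z] \subset _)); last first.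
  by apply/subsetP=> w; rewrite !inE => /orP [/orP []|] /eqP ->; rewrite ?xS ?yS ?zS.
by rewrite -setUA cardsU1 cards2 !inE negb_or xy xz yz.
Qed.

Lemma reduced_locally_colorable (T : finType) (e : rel T) h (U : finType)
    (f : rel U) Tv :
  simple_graph e -> hst_rep e None (Some 2) 1 f Tv -> reduced f Tv ->
  (forall C, is_clique e C -> branch_colorable e C h.+2) ->
  locally_colorable f Tv h.+2.
Proof.
move=> se rep red hC q; have [tf _ sT dT _] := rep.
have [/existsP [u qu]|nq] := boolP [exists u, q \in Tv u]; last first.
  by exists (fun=> ord0) => v y z qv; case/existsP: nq; exists v.
set C := [set v | q \in Tv v].
have [c cP] : branch_colorable e C h.+2.
  by apply: hC; apply: reduced_clique se rep red _; exists u.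
have [par [d rf]] := tree_rooted q tf.
pose A y := [set v in C | y \in Tv v].
have AP v y : (v \in A y) = (q \in Tv v) && (y \in Tv v) by rewrite !inE.
pose leaf y := [exists z, [&& f q z, y != z, A y != set0 & A y \subset A z]].
have [y|g gP] := @fin_all_exists U (fun=> U) (fun y z => leaf y ->
    [&& f q z, y != z, A y != set0 & A y \subset A z]).
  by have [/existsP [z zP]|_] := boolP (leaf y); [exists z | exists y].
(* Reducedness at the edge from [y] to [q] supplies a path [w y] through [y] that avoids [q]; it
   represents [y] in the branch graph. *)
have [y|w wP] := @fin_all_exists U (fun=> T) (fun y w => f q y -> A y != set0 ->
    y \in Tv w /\ q \notin Tv w).
  have [/andP [fy /set0Pn [v]]|ny] := boolP (f q y && (A y != set0)); last first.
    by exists u => fy Ay; rewrite fy Ay in ny.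
  rewrite AP => /andP [qv yv].
  have [||w yw qw] := red y q; first by rewrite (rooted_sym rf).
    by exists v.
  by exists w.
(* A leaf y shares paths only with its partner g y, so it can be coloured last. *)
have partner v y z : leaf y -> q \in Tv v -> y \in Tv v -> z \in Tv v ->
    f q y -> f q z -> y != z -> z = g y.
  move=> /gP /and4P [fg yg _ sub] qv yv zv fy fz yz.
  have : v \in A (g y) by rewrite (subsetP sub) // AP qv.
  by rewrite AP => /andP [_ gv]; apply: (deg2_nbr (dT v) qv yv zv gv).
pose other (a : 'I_h.+2) : 'I_h.+2 := if a == ord0 then lift ord0 ord0 else ord0.
have otherP a : other a != a.
  by rewrite /other; have [->|] := eqVneq a ord0; rewrite // eq_sym.
(* A leaf avoids the colour of its partner. When two leaves are partners of each other, [enum_rank]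
   decides which one gets [ord0]. Two available colours suffice for this. *)
pose col y := if leaf y then
   if leaf (g y) then (if enum_rank y < enum_rank (g y) then ord0 else other ord0)
   else other (c (w (g y)))
  else c (w y).
exists col => v y z qv.
have leaf_sep x t : x \in Tv v -> t \in Tv v -> f q x -> f q t -> x != t ->
    leaf x -> col x != col t.
  move=> xv tv fx ft xt lx; have Et := partner v x t lx qv xv tv fx ft xt.
  rewrite /col lx -Et; have [lt|nlt] := boolP (leaf t); last exact: otherP.
  have tx : t != x by rewrite eq_sym.
  rewrite -(partner v t x lt qv tv xv ft fx tx) lx.
  have : enum_rank x != enum_rank t by rewrite (inj_eq enum_rank_inj).
  rewrite neq_ltn => /orP [lt1|lt1]; rewrite lt1 ltnNge (ltnW lt1); last exact: otherP.
  by rewrite eq_sym; apply: otherP.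
move=> yv zv fy fz yz.
have [ly|nly] := boolP (leaf y); first exact: leaf_sep.
have [lz|nlz] := boolP (leaf z).
  by rewrite eq_sym; apply: leaf_sep => //; rewrite eq_sym.
rewrite /col (negPf nly) (negPf nlz); apply: cP.
(* For neighbours that are not leaves, failure of inclusion in both directions is condition (3) of
   the branch graph. *)
have nsub x t : x \in Tv v -> f q t -> x != t -> ~~ leaf x ->
    exists2 a, a \in A x & a \notin A t.
  move=> xv ft xt nlx; have : ~~ (A x \subset A t); last by case/subsetPn=> a; exists a.
  apply: contra nlx => sub; apply/existsP; exists t; rewrite ft xt sub andbT.
  by apply/set0Pn; exists v; rewrite AP qv.
have Aw x : x \in Tv v -> f q x ->
    [/\ x \in Tv (w x), w x \notin C & forall a, a \in Tv (w x) -> anc_rel q par a x].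
  move=> xv fx; have [|xw qw] := wP x fx; first by apply/set0Pn; exists v; rewrite AP qv.
  by split; rewrite ?inE // => a; apply: (subtree_branch rf (sT _)).
have nC x t : x \in C -> t \notin C -> x != t.
  by move=> xC; apply: contraNneq => <-.
(* [w x] lives entirely in the branch of [x], so a path through [q] can meet it only by passing
   through [x]. *)
have adjA x t : x \in Tv v -> f q x -> t \in C -> e t (w x) = (x \in Tv t).
  move=> xv fx tC; have [xw wC wa] := Aw x xv fx.
  apply/(rep_adjP rep (nC _ _ tC wC))/idP=> [[a at_ aw]|xt]; last by exists x.
  by apply: (subtree_anc rf (sT t) _ (wa a aw) at_); move: tC; rewrite inE.
have vC : v \in C by rewrite inE.
have [yw wyC wya] := Aw y yv fy; have [zw wzC wza] := Aw z zv fz.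
have AC a x : a \in A x -> a \in C by rewrite inE => /andP [].
have br x : x \in Tv v -> f q x -> w x \notin C -> w x \in branch_vertices e C.
  move=> xv fx wC; rewrite inE wC; apply/existsP; exists v.
  by rewrite vC se.1 adjA.
have disj a : a \in Tv (w y) -> a \in Tv (w z) -> False.
  by move=> /wya ay /wza az; rewrite (anc_children_eq rf fy fz ay az) eqxx in yz.
split; rewrite ?br //.
- have ne : w y != w z by apply/eqP=> E; apply: (disj y) => //; rewrite -E.
  by apply/negP=> /(rep_adjP rep ne) [a /disj].
- by exists v => //; rewrite !adjA // yv.
split.
  have [a aAy aAz] := nsub y z yv fz yz nly; have aC := AC _ _ aAy.
  by exists a; rewrite // !adjA //; move: aAy aAz; rewrite !AP => /andP [-> ->].
have zy : z != y by rewrite eq_sym.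
have [a aAz aAy] := nsub z y zv fy zy nlz; have aC := AC _ _ aAz.
by exists a; rewrite // !adjA //; move: aAz aAy; rewrite !AP => /andP [-> ->].
Qed.

(** * Splitting a vertex *)

Definition nbrs (U : finType) (f : rel U) (S : {set U}) (x : U) : {set U} :=
  [set y in S | f x y].

Section Split.
Variables (U : finType) (f : rel U) (q i j : U) (par : U -> U) (d : U -> nat).
Hypotheses (rf : rooted f q par d) (fi : f q i) (fj : f q j) (nij : i != j).

(** [None] is the new vertex, inserted between [q] and its children [i] and [j]. *)
Definition split_par (x : option U) : option U :=
  if x is Some a then if (a == i) || (a == j) then None else Some (par a)
  else Some q.

Definition split_adj : rel (option U) := fun x y =>
  up_rel (Some q) split_par x y || up_rel (Some q) split_par y x.

(** A path acquires the new vertex exactly when it used the edge [qi] or [qj], which is now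
    subdivided. *)
Definition split_set (S : {set U}) : {set option U} :=
  [set x | if x is Some a then a \in S else (q \in S) && ((i \in S) || (j \in S))].

(** Doubling the depths makes room for the new vertex strictly between [q] and its children. *)
Lemma split_rooted : rooted split_adj (Some q) split_par
  (fun x => if x is Some a then (d a).*2 else (d q).*2.+1).
Proof.
have dq a : f q a -> d q < d a.
  move=> fa; have := up_depth rf (up_par par (adj_root_neq rf fa)).
  by rewrite (adj_root_par rf fa).
split=> // -[a|] //= aq; case: ifP => [ij|_].
  by rewrite -doubleS leq_double; case/orP: ij => /eqP ->; apply: dq.
by rewrite ltn_double; apply: (up_depth rf (up_par par _)).
Qed.

Lemma split_adjS a b : split_adj (Some a) (Some b) ->
  f a b /\ (a = q -> (b != i) && (b != j)).
Proof.
have up_adj x y : up_rel (Some q) split_par (Some x) (Some y) ->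
    [/\ up_rel q par x y, x != i & x != j].
  rewrite /up_rel /=; case: ifP => [_ /andP [_ /eqP //]|/norP [xi xj]].
  by rewrite !(inj_eq Some_inj).
rewrite (rooted_adj rf) => /orP [] /up_adj [uxy ni nj]; rewrite uxy ?orbT; split=> //.
  by case/andP: uxy => + _ E; rewrite E eqxx.
by rewrite ni nj.
Qed.

Lemma split_adjN a : split_adj None (Some a) = [|| a == q, a == i | a == j].
Proof.
rewrite /split_adj /up_rel /= !(inj_eq Some_inj) (eq_sym q).
by have [//|aq] := eqVneq a q; case: ifP.
Qed.

Lemma split_adjNN : split_adj None None = false.
Proof. by rewrite (rooted_irr split_rooted). Qed.

Lemma split_adj_some a b :
  f a b -> (a = q -> (b != i) && (b != j)) -> (b = q -> (a != i) && (a != j)) ->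
  split_adj (Some a) (Some b).
Proof.
have up_adj x y : up_rel q par x y -> (y = q -> (x != i) && (x != j)) ->
    up_rel (Some q) split_par (Some x) (Some y).
  move=> /andP [xq /eqP Ep] h; rewrite /up_rel /=.
  case: ifP => [ij|_]; last by rewrite !(inj_eq Some_inj) xq Ep eqxx.
  have /h : y = q by rewrite -Ep; case/orP: ij => /eqP ->; apply: (adj_root_par rf).
  by rewrite -negb_or ij.
rewrite (rooted_adj rf) => /orP [] u h1 h2; apply/orP; [left|right]; exact: up_adj.
Qed.

Lemma split_subtree S : subtree f S -> subtree split_adj (split_set S).
Proof.
case=> /set0Pn [s sS] cS; split; first by apply/set0Pn; exists (Some s); rewrite inE.
have fS := rooted_sym rf.
have rS := restr_sym (split_set S) (rooted_sym split_rooted).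
set R := restr split_adj (split_set S) in rS *.
have qR a : q \in S -> a \in S -> (a == i) || (a == j) -> connect R (Some q) (Some a).
  move=> qS aS ij.
  have NS : None \in split_set S.
    by rewrite inE qS; case/orP: ij => /eqP <-; rewrite aS ?orbT.
  apply: (@connect_trans _ _ None); apply: connect1; rewrite /R /restr /= NS !inE ?qS ?aS.
    by rewrite (rooted_sym split_rooted) split_adjN eqxx.
  by rewrite split_adjN ij orbT.
have SS a b : a \in S -> b \in S -> connect R (Some a) (Some b).
  move=> aS bS; apply: (connect_morph _ (cS a b aS bS)) => x y /and3P [fxy xS yS].
  have [/andP [/eqP xq ij]|n1] := boolP ((x == q) && ((y == i) || (y == j))).
    by rewrite xq; apply: qR; rewrite // -xq.
  have [/andP [/eqP yq ij]|n2] := boolP ((y == q) && ((x == i) || (x == j))).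
    by rewrite (sym_connect_sym rS) yq; apply: qR; rewrite // -yq.
  apply: connect1; rewrite /R /restr /= !inE xS yS !andbT.
  apply: split_adj_some => // E.
    by rewrite -negb_or; move: n1; rewrite E eqxx.
  by rewrite -negb_or; move: n2; rewrite E eqxx.
have SN a : a \in S -> None \in split_set S -> connect R (Some a) None.
  move=> aS NS; have := NS; rewrite inE => /andP [qS _].
  apply: connect_trans (SS a q aS qS) _; apply: connect1.
  by rewrite /R /restr /= NS inE qS (rooted_sym split_rooted) split_adjN eqxx.
move=> [a|] [b|] aS bS //.
- by apply: SS; [move: aS | move: bS]; rewrite inE.
- by apply: SN => //; move: aS; rewrite inE.
- by rewrite (sym_connect_sym rS); apply: SN => //; move: bS; rewrite inE.
Qed.

(** Folding the new vertex back onto [q] is injective on these neighbours: away from [q], only [i]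
    and [j] see the new vertex, and they have lost [q]. *)
Lemma split_nbrs_neq (S : {set U}) a : a \in S -> a != q ->
  #|nbrs split_adj (split_set S) (Some a)| <= #|nbrs f S a|.
Proof.
move=> aS aq; pose phi x := if x is Some b then b else q.
have NP : None \in nbrs split_adj (split_set S) (Some a) ->
    [/\ q \in S, f a q & (a == i) || (a == j)].
  rewrite !inE (rooted_sym split_rooted) split_adjN (negPf aq) /= => /andP [/andP [qS _] ij].
  by split=> //; rewrite (rooted_sym rf); case/orP: ij => /eqP ->.
have Nq : None \in nbrs split_adj (split_set S) (Some a) ->
    Some q \notin nbrs split_adj (split_set S) (Some a).
  case/NP=> _ _ ij; rewrite !inE (rooted_sym split_rooted).
  apply/negP=> /andP [_ /split_adjS [_ /(_ erefl)]].
  by rewrite -negb_or ij.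
rewrite -(card_in_imset (f := phi)); last first.
  move=> [x|] [y|] //= xN yN E; first by rewrite E.
    by move: (Nq yN); rewrite -E xN.
  by move: (Nq xN); rewrite E yN.
apply/subset_leq_card/subsetP=> _ /imsetP [[b|] bN ->] /=; last first.
  by have [qS fa _] := NP bN; rewrite inE qS.
by move: bN; rewrite !inE => /andP [-> /split_adjS []].
Qed.

(** At [q] the new vertex stands for [i] or [j]. If both belong to [S], two neighbours become one;
    with [S] the whole host, this is the drop in degree that drives the induction. *)
Lemma split_nbrs_center (S : {set U}) : q \in S ->
  #|nbrs split_adj (split_set S) (Some q)| + ((i \in S) && (j \in S)) <= #|nbrs f S q|.
Proof.
move=> qS; pose k := if i \in S then i else j.
pose phi x := if x is Some b then b else k.
have SP b : Some b \in nbrs split_adj (split_set S) (Some q) ->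
    [/\ b \in S, f q b, b != i & b != j].
  by rewrite !inE => /andP [bS /split_adjS [fb /(_ erefl) /andP []]].
have kij : (k == i) || (k == j) by rewrite /k; case: ifP; rewrite eqxx ?orbT.
have nk b : Some b \in nbrs split_adj (split_set S) (Some q) -> b != k.
  by case/SP=> _ _ bi bj; case/orP: kij => /eqP ->.
have NP : None \in nbrs split_adj (split_set S) (Some q) -> (k \in S) && f q k.
  rewrite !inE qS /= /k => /andP [+ _].
  by case: ifP => [-> //|_ /= ->].
rewrite -(card_in_imset (f := phi)); last first.
  move=> [x|] [y|] //= xN yN E; first by rewrite E.
    by move: (nk _ xN); rewrite E eqxx.
  by move: (nk _ yN); rewrite E eqxx.
have sub : phi @: nbrs split_adj (split_set S) (Some q) \subset nbrs f S q.
  apply/subsetP=> _ /imsetP [[b|] bN ->] /=; rewrite inE; last exact: NP.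
  by have [-> ->] := SP b bN.
have [/andP [iS jS]|_] := boolP (_ && _); last by rewrite addn0 subset_leq_card.
rewrite addn1 (cardsD1 j (nbrs f S q)) inE jS fj add1n ltnS.
apply: subset_leq_card; apply/subsetP=> x xI; rewrite in_setD1 (subsetP sub) // andbT.
case/imsetP: xI => -[b|] bN ->; last by rewrite /= /k iS.
by case: (SP b bN).
Qed.

Lemma split_nbrs_new S : nbrs split_adj S None \subset [set Some q; Some i; Some j].
Proof.
apply/subsetP=> -[a|]; rewrite !inE ?split_adjNN ?andbF // split_adjN.
by case/andP=> _; rewrite !(inj_eq Some_inj) orbA.
Qed.

(** A path through all of [i], [q] and [j] would branch at the new vertex; the hypothesis excludes
    it. *)
Lemma split_deg (S : {set U}) : ~~ [&& q \in S, i \in S & j \in S] ->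
  deg_le f S (Some 2) -> deg_le split_adj (split_set S) (Some 2).
Proof.
move=> nS dS [a|] aS; last first.
  move: aS; rewrite inE => /andP [qS ij]; rewrite qS /= in nS.
  have [k] : exists k, nbrs split_adj (split_set S) None \subset [set Some q; Some k].
    have [iS|iS] := boolP (i \in S); [exists i | exists j]; apply/subsetP=> x xN;
      have xk := subsetP (split_nbrs_new _) x xN; move: xk xN; rewrite !inE => /orP [/orP []|] /eqP -> //=;
      rewrite ?eqxx ?orbT //.
      by move: nS; rewrite iS /= => /negPf ->.
    by rewrite (negPf iS).
  by move/subset_leq_card/leq_trans; apply; rewrite cards2; case: eqP.
have {}aS : a \in S by move: aS; rewrite inE.
have [E|aq] := eqVneq a q; last exact: leq_trans (split_nbrs_neq aS aq) (dS a aS).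
rewrite E in aS *; apply: leq_trans (dS q aS).
exact: leq_trans (leq_addr _ _) (split_nbrs_center aS).
Qed.

(** The new vertex lies only in sets that already contain [q], so no new intersections arise. *)
Lemma split_meet (S S' : {set U}) :
  (0 < #|split_set S :&: split_set S'|) = (0 < #|S :&: S'|).
Proof.
apply/card_gt0P/card_gt0P=> [[[a|]]|[a]]; rewrite !inE.
- by move=> aP; exists a; rewrite inE.
- by case/andP=> /andP [qS _] /andP [qS' _]; exists q; rewrite inE qS.
- by move=> aP; exists (Some a); rewrite !inE.
Qed.

Lemma split_locally_colorable (T : finType) (Tv : T -> {set U}) h
    (col : U -> 'I_h.+3) :
  (forall v y z, q \in Tv v -> y \in Tv v -> z \in Tv v -> f q y -> f q z ->
     y != z -> col y != col z) ->
  col i = col j -> locally_colorable f Tv h.+3 ->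
  locally_colorable split_adj (fun v => split_set (Tv v)) h.+3.
Proof.
move=> colP cij lc.
have lift_col p (c : U -> 'I_h.+3) (cN : 'I_h.+3) :
    (forall v y z, p \in Tv v -> y \in Tv v -> z \in Tv v -> f p y -> f p z ->
       y != z -> c y != c z) ->
    (forall v z, p \in Tv v -> None \in split_set (Tv v) -> z \in Tv v ->
       split_adj (Some p) None -> split_adj (Some p) (Some z) -> c z != cN) ->
    exists c' : option U -> 'I_h.+3, forall v y z, Some p \in split_set (Tv v) ->
      y \in split_set (Tv v) -> z \in split_set (Tv v) ->
      split_adj (Some p) y -> split_adj (Some p) z -> y != z -> c' y != c' z.
  move=> cP cNP; exists (fun x => if x is Some a then c a else cN).
  move=> v y z; rewrite inE => pv; case: y z => [y|] [z|] yS zS fy fz yz //.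
  - apply: (cP v) => //; first by move: yS; rewrite inE.
    + by move: zS; rewrite inE.
    + by have [] := split_adjS fy.
    + by have [] := split_adjS fz.
  - by apply: (cNP v) => //; move: yS; rewrite inE.
  - by rewrite eq_sym; apply: (cNP v) => //; move: zS; rewrite inE.
case=> [p|]; last first.
  (* The three neighbours of the new vertex get three different colours, which requires at least
     three colours. *)
  pose c x : 'I_h.+3 := if x == Some q then ord0
    else if x == Some i then lift ord0 ord0 else ord_max.
  exists c => v y z _ _ _ fy fz.
  have new x : split_adj None x -> x \in [set Some q; Some i; Some j].
    by move=> fx; apply: (subsetP (split_nbrs_new setT)); rewrite in_set in_setT.
  have iq : Some i != Some q := adj_root_neq rf fi.
  have jq : Some j != Some q := adj_root_neq rf fj.
  have ji : Some j != Some i by rewrite eq_sym.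
  by move: (new y fy) (new z fz); rewrite !inE => /orP [/orP []|] /eqP ->
    /orP [/orP []|] /eqP ->; rewrite /c ?eqxx ?(negPf iq) ?(negPf jq) ?(negPf ji) ?eqxx.
have [->|pq] := eqVneq p q.
  (* At [q] the new vertex inherits the common colour of [i] and [j]. *)
  apply: (lift_col q col (col i)) => // v z qv + zv _ /split_adjS [fz /(_ erefl) /andP [zi zj]].
  by rewrite inE => /andP [_ /orP [iv|jv]]; [|rewrite cij]; apply: (colP v).
(* At any other [p] the new vertex takes the colour of [q]: it is adjacent to [p] only if [p] is [i]
   or [j], and there it replaces [q]. *)
have [c cP] := lc p; apply: (lift_col p c (c q)) => // v z pv + zv.
rewrite inE (rooted_sym split_rooted) split_adjN (negPf pq) /= => /andP [qv _] ij fz.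
have [fpz _] := split_adjS fz.
apply: (cP v) => //; first by rewrite (rooted_sym rf); case/orP: ij => /eqP ->.
apply: contraTneq fz => ->; rewrite (rooted_sym split_rooted).
by apply/negP=> /split_adjS [_ /(_ erefl)]; rewrite -negb_or ij.
Qed.

End Split.

(** * Bounding the host degree by induction on the excess *)

Definition excess (U : finType) (f : rel U) (h : nat) : nat :=
  \sum_(x : U) (#|nbrs f setT x| - h).

Lemma sum_option (U : finType) (F : option U -> nat) :
  \sum_x F x = F None + \sum_(a : U) F (Some a).
Proof.
rewrite (bigD1 None) //=; congr addn.
case: (pickP (mem U)) => [u _|U0]; last first.
  by rewrite !big1 // => [a|[a|] //]; have := U0 a.
rewrite (reindex_onto Some (odflt u)) => [|[a|] //].
by apply: eq_bigl => a; rewrite /= eqxx.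
Qed.

(** Each split strictly lowers the excess: [q], whose degree is above the bound, loses a neighbour,
    no other old vertex gains one, and the new vertex has degree at most 3, within the bound. *)
Lemma bounded_degree_rep (T : finType) (e : rel T) h (U : finType) (f : rel U) Tv :
  hst_rep e None (Some 2) 1 f Tv -> locally_colorable f Tv h.+3 ->
  in_hst e (Some h.+3) (Some 2) 1.
Proof.
have [n] := ubnP (excess f h.+3).
elim: n U f Tv => // n IH U f Tv lt_n rep lc.
have [tf _ sT dT adj] := rep.
have [/existsP [q degq]|nd] := boolP [exists q, h.+3 < #|nbrs f setT q|]; last first.
  exists U, f, Tv; split=> // x _; rewrite leqNgt.
  by apply: contra nd => dx; apply/existsP; exists x.
have [col colP] := lc q.
have : ~~ dinjectiveb col (mem (nbrs f setT q)).
  by apply: contraL degq => /dinjectiveP /leq_card_in; rewrite card_ord -leqNgt.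
case/dinjectivePn=> i; rewrite !inE /= => fi [j].
rewrite !inE /= => /andP [nji fj] cij.
have nij : i != j by rewrite eq_sym.
have [par [d rf]] := tree_rooted q tf.
(* This turns the neighbour counts inside a set into counts of host degrees. *)
have sTrue : split_set q i j setT = setT by apply/setP=> -[a|]; rewrite !inE.
apply: (IH _ (split_adj q i j par) (fun v => split_set q i j (Tv v))).
- rewrite ltnS in lt_n; apply: leq_trans lt_n; rewrite /excess sum_option.
  have -> : #|nbrs (split_adj q i j par) setT None| - h.+3 = 0.
    apply/eqP; rewrite subn_eq0.
    apply: leq_trans (subset_leq_card (split_nbrs_new rf fi fj _)) _.
    rewrite -setUA; apply: leq_trans (leq_card_setU _ _) _.
    by rewrite cards1 cards2; case: eqP.
  rewrite add0n (bigD1 q) //= [X in _ <= X](bigD1 q) //= -addSn.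
  apply: leq_add; last first.
    apply: leq_sum => a aq; apply: leq_sub2r; rewrite -sTrue.
    by apply: (split_nbrs_neq rf fi fj); rewrite ?inE.
  apply: ltn_sub2r degq _.
  by have := split_nbrs_center rf fi fj nij (in_setT q); rewrite sTrue !inE addn1.
- split=> //; first exact: (rooted_tree (split_rooted rf fi fj)).
  + by move=> v; apply: (split_subtree rf fi fj).
  + move=> v; apply: (split_deg rf fi fj nij) => //.
    apply/negP=> /and3P [qv iv jv].
    by have := colP v i j qv iv jv fi fj nij; rewrite cij eqxx.
  + by move=> v w /adj; rewrite split_meet.
exact: (split_locally_colorable rf fi fj nij colP).
Qed.

Theorem mainTheorem4 (T : finType) (e : rel T) :
  simple_graph e -> connected_graph e -> VPT e ->
  (forall h : nat, 3 <= h ->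
     (in_hst e (Some h) (Some 2) 1 <->
      (forall C : {set T}, is_clique e C -> branch_colorable e C h))) /\
  (in_hst e (Some 2) (Some 2) 1 ->
      (forall C : {set T}, is_clique e C -> branch_colorable e C 2)).
Proof.
move=> se [/card_gt0P [t0 _] _] [U [f [Tv rep]]].
have fwd h : in_hst e (Some h.+1) (Some 2) 1 ->
    forall C : {set T}, is_clique e C -> branch_colorable e C h.+1.
  case=> U' [f' [Tv' rep']] C cC; apply: (rep_branch_colorable se rep') => //.
  (* The empty set is not maximal, because the graph has the vertex [t0]. *)
  apply/negP=> /eqP C0; have [_ /(_ t0)] := cC; rewrite C0 inE => /(_ isT) [x].
  by rewrite inE.
split; last exact: fwd.
case=> [|[|[|h]]] // _; split; first exact: fwd.
move=> hC; have [f' [Tv' [rep' red]]] := reduced_rep rep.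
by apply: (bounded_degree_rep rep'); apply: reduced_locally_colorable se rep' red hC.
Qed.
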